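(* Let $(A,A^* )$ be a dendriform D-bialgebra, let $\mathfrak{d}=A\oplus A^*$ be its dendriform double, let $\{e_1,\dots,e_n\}$ be a basis of $A$ with dual basis $\{e_1^*,\dots,e_n^*\}$ of $A^*$, and let $r=\sum_i e_i\otimes e_i^*\in A\otimes A^*\subset\mathfrak{d}\otimes\mathfrak{d}$. Then the dendriform D-bialgebra $(\mathfrak{d},\mathfrak{d}_r^* )$ is a quasi-triangular dendriform D-bialgebra. Moreover, it is factorizable.
   Context: All vector spaces are finite-dimensional over a field $\mathbb{K}$ of characteristic different from $2$. A dendriform algebra $(A,\prec_A,\succ_A)$ is a vector space with two bilinear products such that, with $x\ast y=x\prec_A y+x\succ_A y$, for all $x,y,z$: $(x\prec_A y)\prec_A z=x\prec_A(y\ast z)$, $(x\succ_A y)\prec_A z=x\succ_A(y\prec_A z)$, $x\succ_A(y\succ_A z)=(x\ast y)\succ_A z$. For any dendriform algebra $A$ put $L_{\succ_A}(x)y=x\succ_A y$, $L_{\prec_A}(x)y=x\prec_A y$, $R_{\succ_A}(x)y=y\succ_A x$, $R_{\prec_A}(x)y=y\prec_A x$, $\mathcal{L}_A=L_{\prec_A}+L_{\succ_A}$, $\mathcal{R}_A=R_{\prec_A}+R_{\succ_A}$; for $F:A\to\mathfrak{gl}(A)$ define $F^*:A\to\mathfrak{gl}(A^* )$ by $\langle F^*(x)\xi,y\rangle=\langle\xi,F(x)y\rangle$ (no sign). The same notation is used for a dendriform algebra structure on $A^*$ (with $A^{**}=A$). Dendriform D-bialgebra $(A,A^* )$: dendriform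 algebra structures $(\prec_A,\succ_A)$ on $A$ and $(\prec_{A^*},\succ_{A^*})$ on $A^*$ such that, writing $\Delta_\prec,\Delta_\succ:A\to A\otimes A$ for the linear duals of $\prec_{A^*},\succ_{A^*}$ and $\beta_\prec,\beta_\succ:A^*\to A^*\otimes A^*$ for the linear duals of $\prec_A,\succ_A$ (e.g. $\langle\Delta_\prec(x),\xi\otimes\eta\rangle=\langle x,\xi\prec_{A^*}\eta\rangle$), and $\sigma,\sigma'$ for the flips on $A\otimes A$, $A^*\otimes A^*$, for all $x,y\in A$, $\xi,\eta\in A^*$: (1) $\Delta_\prec(x\ast y)=(\mathrm{Id}\otimes L_{\succ_A}(x))\Delta_\prec(y)+(\mathcal{R}_A(y)\otimes\mathrm{Id})\Delta_\prec(x)$; (2) $\Delta_\succ(x\ast y)=(\mathrm{Id}\otimes\mathcal{L}_A(x))\Delta_\succ(y)+(R_{\prec_A}(y)\otimes\mathrm{Id})\Delta_\succ(x)$; (3) $\beta_\prec(\xi\prec_{A^*}\eta+\xi\succ_{A^*}\eta)=(\mathrm{Id}\otimes L_{\succ_{A^*}}(\xi))\beta_\prec(\eta)+(\mathcal{R}_{A^*}(\eta)\otimes\mathrm{Id})\beta_\prec(\xi)$; (4) $\beta_\succ(\xi\prec_{A^*}\eta+\xi\succ_{A^*}\eta)=(\mathrm{Id}\otimes\mathcal{L}_{A^*}(\xi))\beta_\succ(\eta)+(R_{\prec_{A^*}}(\eta)\otimes\mathrm{Id})\beta_\succ(\xi)$; (5) $(\mathcal{L}_A(x)\otimes\mathrm{Id}-\mathrm{Id}\otimes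 R_{\prec_A}(x))\Delta_\prec(y)+\sigma\big((L_{\succ_A}(y)\otimes\mathrm{Id}-\mathrm{Id}\otimes\mathcal{R}_A(y))\Delta_\succ(x)\big)=0$; (6) $(\mathcal{L}_{A^*}(\xi)\otimes\mathrm{Id}-\mathrm{Id}\otimes R_{\prec_{A^*}}(\xi))\beta_\prec(\eta)+\sigma'\big((L_{\succ_{A^*}}(\eta)\otimes\mathrm{Id}-\mathrm{Id}\otimes\mathcal{R}_{A^*}(\eta))\beta_\succ(\xi)\big)=0$. Dendriform double: $\mathfrak{d}=A\oplus A^*$ with the dendriform algebra structure $$(x,\xi)\succ_{\mathfrak{d}}(y,\eta)=\big(x\succ_A y-L_{\prec_{A^*}}^*(\eta)x+\mathcal{R}_{A^*}^*(\xi)y,\ \xi\succ_{A^*}\eta+\mathcal{R}_A^*(x)\eta-L_{\prec_A}^*(y)\xi\big),$$ $$(x,\xi)\prec_{\mathfrak{d}}(y,\eta)=\big(x\prec_A y+\mathcal{L}_{A^*}^*(\eta)x-R_{\succ_{A^*}}^*(\xi)y,\ \xi\prec_{A^*}\eta-R_{\succ_A}^*(x)\eta+\mathcal{L}_A^*(y)\xi\big).$$ The space $\mathfrak{d}^*=A^*\oplus A$ (canonical pairing) with products $(\xi,x)\prec(\eta,y)=(\xi\prec_{A^*}\eta,x\prec_A y)$, $(\xi,x)\succ(\eta,y)=(\xi\succ_{A^*}\eta,x\succ_A y)$ is denoted $\mathfrak{d}_r^*$; it is a known result (Bai) that $(\mathfrak{d},\mathfrak{d}_r^* )$ is a dendriform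 D-bialgebra, with these products being the products $\prec_r,\succ_r$ induced by $r$ as below (with $A$ replaced by $\mathfrak{d}$). For a dendriform algebra $A$ and $r=\sum_i a_i\otimes b_i\in A\otimes A$, define $r_+,r_-:A^*\to A$ by $r(\xi,\eta)=\langle r_+(\xi),\eta\rangle=\langle\xi,r_-(\eta)\rangle$, $I=r_+-r_-$, and the skew-symmetric part $a=\frac12(r-\sigma(r))$. The induced products on $A^*$ are $\xi\succ_r\eta=\mathcal{R}_A^*(r_+(\xi))\eta-L_{\prec_A}^*(r_-(\eta))\xi$ and $\xi\prec_r\eta=\mathcal{L}_A^*(r_+(\eta))\xi-R_{\succ_A}^*(r_-(\xi))\eta$; $A^*$ with them is denoted $A_r^*$. An element $s\in A\otimes A$ is $(L_\succ,R_\prec)$-invariant if $(\mathrm{Id}\otimes\mathcal{L}_A(x)-R_{\prec_A}(x)\otimes\mathrm{Id})s=0$ and $(\mathrm{Id}\otimes L_{\succ_A}(x)-\mathcal{R}_A(x)\otimes\mathrm{Id})\sigma(s)=0$ for all $x\in A$. The D-equation for $r$ is $$\sum_{i,j}(a_i\ast a_j)\otimes b_i\otimes b_j-\sum_{i,j}a_i\otimes a_j\otimes(b_i\prec_A b_j)-\sum_{i,j}a_j\otimes(a_i\succ_A b_j)\otimes b_i=0.$$ The dendriform D-bialgebra $(A,A_r^* )$ is quasi-triangular if $r$ satisfies the D-equation and $a$ is $(L_\succ,R_\prec)$-invariant; it is factorizable if moreover $I:A^*\to A$ is a linear isomorphism. *)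

(* Defs.v *)
From HB Require Import structures.
From mathcomp Require Import all_boot all_order all_algebra.

Set Implicit Arguments.
Unset Strict Implicit.
Unset Printing Implicit Defensive.

Import GRing.Theory.
Local Open Scope ring_scope.

(** [linfun] and [mkbil] accept any function, but are meaningful only on
    (bi)linear ones: for each use below, the lemma ending in [E] establishes
    that the resulting map has the intended values. *)

Lemma linfun_linE (K : fieldType) (A B : vectType K) (f : A -> B) (x : A) :
  linear f -> linfun f x = f x.
Proof.
move=> lf; pose m := GRing.isLinear.Build _ _ _ _ f lf.
pose g : {linear A -> B} := HB.pack f m.
by rewrite (lfunE g).
Qed.

Definition mkbil (K : fieldType) (A B C : vectType K) (f : A -> B -> C) :
    'Hom(A, 'Hom(B, C)) :=
  linfun (fun x => linfun (f x)).

Lemma mkbilE (K : fieldType) (A B C : vectType K) (f : A -> B -> C) x y :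
  (forall u, linear (f u)) -> (forall v, linear (f^~ v)) ->
  mkbil f x y = f x y.
Proof.
move=> lr ll; rewrite /mkbil linfun_linE ?linfun_linE //.
move=> a u v; apply/lfunP=> z.
by rewrite add_lfunE scale_lfunE !linfun_linE // ll.
Qed.

Definition dual (K : fieldType) (A : vectType K) : vectType K := 'Hom(A, K^o).

Lemma dual_sep (K : fieldType) (A : vectType K) (x : A) :
  (forall xi : dual A, xi x = 0) -> x = 0.
Proof.
move=> x0; rewrite (coord_vbasis (memvf x)) big1 // => i _.
have := x0 (linfun (coord (vbasis {:A}) i : A -> K^o)).
by rewrite lfunE /= => ->; rewrite scale0r.
Qed.

(** The canonical identification of [A] with its bidual. *)

Definition ev (K : fieldType) (A : vectType K) : 'Hom(A, dual (dual A)) :=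
  mkbil (fun (x : A) (xi : dual A) => xi x).

Definition unev (K : fieldType) (A : vectType K) : 'Hom(dual (dual A), A) :=
  ((ev A)^-1)%VF.

Arguments ev {K A}.
Arguments unev {K A}.

Lemma evE (K : fieldType) (A : vectType K) (x : A) (xi : dual A) :
  ev x xi = xi x.
Proof.
rewrite /ev mkbilE // => [u|v] a b c; last by rewrite linearP.
by rewrite add_lfunE scale_lfunE.
Qed.

Lemma dim_dual (K : fieldType) (A : vectType K) : dim (dual A) = dim A.
Proof. exact: muln1. Qed.

Lemma lker_ev (K : fieldType) (A : vectType K) : lker (@ev K A) == 0%VS.
Proof.
apply/lker0P=> x y exy; apply/eqP; rewrite -subr_eq0; apply/eqP.
by apply: dual_sep => xi; rewrite linearB /= -(evE x) exy evE subrr.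
Qed.

Lemma evK (K : fieldType) (A : vectType K) : cancel (@ev K A) unev.
Proof. exact/lker0_lfunK/lker_ev. Qed.

Lemma unevK (K : fieldType) (A : vectType K) : cancel (@unev K A) ev.
Proof.
move=> u; rewrite limg_lfunVK // (_ : limg _ = fullv) ?memvf //.
apply/eqP; rewrite eqEdim subvf limg_dim_eq /=; last first.
  by rewrite (eqP (lker_ev A)) capv0.
by rewrite !dimvf !dim_dual.
Qed.

(** [A (x) B] is modelled by the bilinear forms on [A^* x B^*];
    [tens_universal] is its universal property. *)

Definition tensor (K : fieldType) (A B : vectType K) : vectType K :=
  'Hom(dual A, 'Hom(dual B, K^o)).

Definition tens (K : fieldType) (A B : vectType K) (a : A) (b : B) :
    tensor A B :=
  mkbil (fun (xi : dual A) (eta : dual B) => xi a * eta b : K^o).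

Definition flip (K : fieldType) (A B : vectType K) (t : tensor A B) :
    tensor B A :=
  mkbil (fun (eta : dual B) (xi : dual A) => t xi eta).

Definition tmap (K : fieldType) (A A' B B' : vectType K)
    (f : 'Hom(A, A')) (g : 'Hom(B, B')) (t : tensor A B) : tensor A' B' :=
  mkbil (fun (xi : dual A') (eta : dual B') => t (xi \o f)%VF (eta \o g)%VF).

Lemma tensE (K : fieldType) (A B : vectType K) (a : A) (b : B)
    (xi : dual A) (eta : dual B) : tens a b xi eta = xi a * eta b.
Proof.
rewrite /tens mkbilE // => u c v w; rewrite add_lfunE scale_lfunE.
  by rewrite mulrDr scalerAr.
by rewrite mulrDl scalerAl.
Qed.

Lemma flipE (K : fieldType) (A B : vectType K) (t : tensor A B) xi eta :
  flip t eta xi = t xi eta.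
Proof.
rewrite /flip mkbilE // => u c v w; last by rewrite linearP.
by rewrite linearP /= add_lfunE scale_lfunE.
Qed.

Lemma tmapE (K : fieldType) (A A' B B' : vectType K)
    (f : 'Hom(A, A')) (g : 'Hom(B, B')) (t : tensor A B) xi eta :
  tmap f g t xi eta = t (xi \o f)%VF (eta \o g)%VF.
Proof.
rewrite /tmap mkbilE // => u c v w; rewrite comp_lfunDl -comp_lfunZl linearP //.
by rewrite /= add_lfunE scale_lfunE.
Qed.

Lemma tensor_ext (K : fieldType) (A B : vectType K) (t s : tensor A B) :
  (forall xi eta, t xi eta = s xi eta) -> t = s.
Proof. by move=> ts; apply/lfunP=> xi; apply/lfunP=> eta; apply: ts. Qed.

Lemma flip_tens (K : fieldType) (A B : vectType K) (a : A) (b : B) :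
  flip (tens a b) = tens b a.
Proof. by apply: tensor_ext => xi eta; rewrite flipE !tensE mulrC. Qed.

Lemma tmap_tens (K : fieldType) (A A' B B' : vectType K)
    (f : 'Hom(A, A')) (g : 'Hom(B, B')) (a : A) (b : B) :
  tmap f g (tens a b) = tens (f a) (g b).
Proof. by apply: tensor_ext => xi eta; rewrite tmapE !tensE !comp_lfunE. Qed.

Lemma tens_linearl (K : fieldType) (A B : vectType K) (b : B) :
  linear ((@tens K A B)^~ b).
Proof.
move=> c u v; apply: tensor_ext => xi eta.
rewrite !add_lfunE !scale_lfunE !tensE.
by rewrite linearP mulrDl scalerAl.
Qed.

Lemma tens_linearr (K : fieldType) (A B : vectType K) (a : A) :
  linear (@tens K A B a).
Proof.
move=> c u v; apply: tensor_ext => xi eta.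
rewrite !add_lfunE !scale_lfunE !tensE.
by rewrite linearP mulrDr scalerAr.
Qed.

Definition vcoord (K : fieldType) (A : vectType K) (i : 'I_(\dim {:A})) :
    dual A := linfun (coord (vbasis {:A}) i : A -> K^o).

Lemma vcoord_sum (K : fieldType) (A : vectType K) (x : A) :
  x = \sum_i vcoord i x *: (vbasis {:A})`_i.
Proof.
rewrite {1}(coord_vbasis (memvf x)); apply: eq_bigr => i _.
by rewrite lfunE.
Qed.

Lemma tens_decomp (K : fieldType) (A B : vectType K) (t : tensor A B) :
  t = \sum_(i < \dim {:A}) tens (vbasis {:A})`_i (unev (t (vcoord i))).
Proof.
apply: tensor_ext => xi eta.
have {1}-> : xi = \sum_(i < \dim {:A}) xi (vbasis {:A})`_i *: vcoord i.
  apply/lfunP=> x; rewrite {1}(vcoord_sum x) linear_sum sum_lfunE.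
  apply: eq_bigr => i _.
  by rewrite linearZ scale_lfunE /= /GRing.scale /= mulrC.
rewrite linear_sum !sum_lfunE; apply: eq_bigr => i _.
by rewrite linearZ scale_lfunE tensE -(evE _ eta) unevK.
Qed.

Lemma tens_universal (K : fieldType) (A B C : vectType K)
    (f : 'Hom(A, 'Hom(B, C))) :
  exists2 F : 'Hom(tensor A B, C), (forall a b, F (tens a b) = f a b)
    & forall G : 'Hom(tensor A B, C), (forall a b, G (tens a b) = f a b) ->
      G = F.
Proof.
pose phi (t : tensor A B) :=
  \sum_(i < \dim {:A}) f (vbasis {:A})`_i (unev (t (vcoord i))).
have lphi : linear phi.
  move=> c t s; rewrite /phi scaler_sumr -big_split; apply: eq_bigr => i _ /=.
  by rewrite add_lfunE scale_lfunE !linearP.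
exists (linfun phi) => [a b|G Gf].
  rewrite linfun_linE // {2}(vcoord_sum a) linear_sum sum_lfunE.
  apply: eq_bigr => i _; rewrite linearZ scale_lfunE -linearZ; congr (f _ _).
  rewrite -(evK b) -linearZ /=; congr (unev _); apply/lfunP=> xi.
  by rewrite tensE scale_lfunE evE evK.
apply/lfunP=> t; rewrite linfun_linE // {1}(tens_decomp t) linear_sum.
by apply: eq_bigr => i _; apply: Gf.
Qed.

(** A pair of bilinear products; [dprec D x] is left multiplication by [x]. *)

Record dend (K : fieldType) (A : vectType K) := Dend {
  dprec : 'Hom(A, 'End(A));
  dsucc : 'Hom(A, 'End(A))
}.

Section Operators.
Variables (K : fieldType) (A : vectType K).

Definition rmult (m : 'Hom(A, 'End(A))) : 'Hom(A, 'End(A)) :=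
  mkbil (fun x y : A => m y x).

Definition Lprec (D : dend A) : 'Hom(A, 'End(A)) := dprec D.
Definition Lsucc (D : dend A) : 'Hom(A, 'End(A)) := dsucc D.
Definition Rprec (D : dend A) : 'Hom(A, 'End(A)) := rmult (dprec D).
Definition Rsucc (D : dend A) : 'Hom(A, 'End(A)) := rmult (dsucc D).
Definition Lall (D : dend A) : 'Hom(A, 'End(A)) := Lprec D + Lsucc D.
Definition Rall (D : dend A) : 'Hom(A, 'End(A)) := Rprec D + Rsucc D.

Definition dast (D : dend A) (x y : A) : A := dprec D x y + dsucc D x y.

(** [F^*] for [F : A -> gl(A)]. *)
Definition adj (F : 'Hom(A, 'End(A))) : 'Hom(A, 'End(dual A)) :=
  mkbil (fun (x : A) (xi : dual A) => (xi \o F x)%VF : dual A).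

(** [F^*] for [F : dual A -> gl(dual A)], with values in [gl(A)] since [A] is
    its own bidual. *)
Definition coadj (F : 'Hom(dual A, 'End(dual A))) : 'Hom(dual A, 'End(A)) :=
  mkbil (fun (xi : dual A) (x : A) =>
           unev ((ev x \o F xi)%VF : dual (dual A))).

(** The linear dual [A -> A (x) A] of a product on [A^*], and the linear dual
    [A^* -> A^* (x) A^*] of a product on [A]. *)
Definition cop (m : 'Hom(dual A, 'End(dual A))) (x : A) : tensor A A :=
  mkbil (fun xi eta : dual A => m xi eta x : K^o).

Definition cocop (m : 'Hom(A, 'End(A))) (xi : dual A) :
    tensor (dual A) (dual A) :=
  mkbil (fun X Y : dual (dual A) => xi (m (unev X) (unev Y)) : K^o).

Lemma rmultE m x y : rmult m x y = m y x.
Proof.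
rewrite /rmult mkbilE // => u c v w; last by rewrite linearP.
by rewrite linearP /= add_lfunE scale_lfunE.
Qed.

Lemma adjE F (x : A) (xi : dual A) (y : A) : adj F x xi y = xi (F x y).
Proof.
rewrite /adj mkbilE ?comp_lfunE // => u c v w; apply/lfunP=> z.
  by rewrite !(add_lfunE, scale_lfunE, comp_lfunE).
by rewrite !(add_lfunE, scale_lfunE, comp_lfunE, linearP).
Qed.

Lemma coadjE F (xi : dual A) (x : A) (eta : dual A) :
  eta (coadj F xi x) = F xi eta x.
Proof.
rewrite /coadj mkbilE => [|u c v w|u c v w].
- by rewrite -evE unevK comp_lfunE evE.
- rewrite -linearP; congr (unev _); apply/lfunP=> z.
  by rewrite !(add_lfunE, scale_lfunE, comp_lfunE, evE, linearP).
- rewrite -linearP; congr (unev _); apply/lfunP=> z.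
  by rewrite !(add_lfunE, scale_lfunE, comp_lfunE, evE, linearP).
Qed.

Lemma copE m x xi eta : cop m x xi eta = m xi eta x.
Proof.
rewrite /cop mkbilE // => u c v w.
  by rewrite linearP !(add_lfunE, scale_lfunE).
by rewrite linearP !(add_lfunE, scale_lfunE).
Qed.

Lemma cocopE m (xi : dual A) (x y : A) : cocop m xi (ev x) (ev y) = xi (m x y).
Proof.
rewrite /cocop mkbilE ?evK // => u c v w.
  by rewrite !linearP.
by rewrite (linearP unev) (linearP m) add_lfunE scale_lfunE linearP.
Qed.

End Operators.

Record dendriform (K : fieldType) (A : vectType K) (D : dend A) : Prop :=
  Dendriform {
  dend_prec_prec : forall x y z,
    dprec D (dprec D x y) z = dprec D x (dast D y z);
  dend_succ_prec : forall x y z,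
    dprec D (dsucc D x y) z = dsucc D x (dprec D y z);
  dend_succ_succ : forall x y z,
    dsucc D x (dsucc D y z) = dsucc D (dast D x y) z
}.

Section Bialgebra.
Variables (K : fieldType) (A : vectType K).

Record dendriform_Dbialgebra (D : dend A) (D' : dend (dual A)) : Prop :=
  DendriformDbialgebra {
  Dbi_dendriform : dendriform D;
  Dbi_dendriform_dual : dendriform D';
  Dbi1 : forall x y,
    cop (dprec D') (dast D x y) =
      tmap \1%VF (Lsucc D x) (cop (dprec D') y)
      + tmap (Rall D y) \1%VF (cop (dprec D') x);
  Dbi2 : forall x y,
    cop (dsucc D') (dast D x y) =
      tmap \1%VF (Lall D x) (cop (dsucc D') y)
      + tmap (Rprec D y) \1%VF (cop (dsucc D') x);
  Dbi3 : forall xi eta,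
    cocop (dprec D) (dprec D' xi eta + dsucc D' xi eta) =
      tmap \1%VF (Lsucc D' xi) (cocop (dprec D) eta)
      + tmap (Rall D' eta) \1%VF (cocop (dprec D) xi);
  Dbi4 : forall xi eta,
    cocop (dsucc D) (dprec D' xi eta + dsucc D' xi eta) =
      tmap \1%VF (Lall D' xi) (cocop (dsucc D) eta)
      + tmap (Rprec D' eta) \1%VF (cocop (dsucc D) xi);
  Dbi5 : forall x y,
    (tmap (Lall D x) \1%VF (cop (dprec D') y)
       - tmap \1%VF (Rprec D x) (cop (dprec D') y))
    + flip (tmap (Lsucc D y) \1%VF (cop (dsucc D') x)
       - tmap \1%VF (Rall D y) (cop (dsucc D') x)) = 0;
  Dbi6 : forall xi eta,
    (tmap (Lall D' xi) \1%VF (cocop (dprec D) eta)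
       - tmap \1%VF (Rprec D' xi) (cocop (dprec D) eta))
    + flip (tmap (Lsucc D' eta) \1%VF (cocop (dsucc D) xi)
       - tmap \1%VF (Rall D' eta) (cocop (dsucc D) xi)) = 0
}.

(** [r_+] and [r_-], characterized by [rplusE] and [rminusE]. *)

Definition rplus (r : tensor A A) : 'Hom(dual A, A) := (unev \o r)%VF.
Definition rminus (r : tensor A A) : 'Hom(dual A, A) := (unev \o flip r)%VF.

Lemma rplusE (r : tensor A A) (xi eta : dual A) : eta (rplus r xi) = r xi eta.
Proof. by rewrite /rplus comp_lfunE -[LHS]evE unevK. Qed.

Lemma rminusE (r : tensor A A) (xi eta : dual A) : xi (rminus r eta) = r xi eta.
Proof. by rewrite /rminus comp_lfunE -[LHS]evE unevK flipE. Qed.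

Definition rI (r : tensor A A) : 'Hom(dual A, A) := rplus r - rminus r.

Definition skew (r : tensor A A) : tensor A A := 2%:R^-1 *: (r - flip r).

Definition induced (D : dend A) (r : tensor A A) : dend (dual A) := Dend
  (mkbil (fun xi eta : dual A =>
     adj (Lall D) (rplus r eta) xi - adj (Rsucc D) (rminus r xi) eta))
  (mkbil (fun xi eta : dual A =>
     adj (Rall D) (rplus r xi) eta - adj (Lprec D) (rminus r eta) xi)).

Lemma induced_precE D r xi eta : dprec (induced D r) xi eta =
  adj (Lall D) (rplus r eta) xi - adj (Rsucc D) (rminus r xi) eta.
Proof.
rewrite /= mkbilE // => u c v w /=.
  by rewrite !(linearP, add_lfunE, scale_lfunE) addrACA -scalerDr.
by rewrite !(linearP, add_lfunE, scale_lfunE) addrACA -scalerDr.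
Qed.

Lemma induced_succE D r xi eta : dsucc (induced D r) xi eta =
  adj (Rall D) (rplus r xi) eta - adj (Lprec D) (rminus r eta) xi.
Proof.
rewrite /= mkbilE // => u c v w /=.
  by rewrite !(linearP, add_lfunE, scale_lfunE) addrACA -scalerDr.
by rewrite !(linearP, add_lfunE, scale_lfunE) addrACA -scalerDr.
Qed.

Definition LR_invariant (D : dend A) (s : tensor A A) : Prop :=
  forall x : A,
    tmap \1%VF (Lall D x) s - tmap (Rprec D x) \1%VF s = 0
    /\ tmap \1%VF (Lsucc D x) (flip s) - tmap (Rall D x) \1%VF (flip s) = 0.

(** The condition does not depend on the decomposition of [r], and one exists
    by [tens_decomp]. *)
Definition D_equation (D : dend A) (r : tensor A A) : Prop :=
  forall (m : nat) (a b : 'I_m -> A), r = \sum_i tens (a i) (b i) ->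
    \sum_i \sum_j tens (dast D (a i) (a j)) (tens (b i) (b j))
    - \sum_i \sum_j tens (a i) (tens (a j) (dprec D (b i) (b j)))
    - \sum_i \sum_j tens (a j) (tens (dsucc D (a i) (b j)) (b i)) = 0.

(** [qt_induced] says that the dual of [A], with [D'], is [A_r^*]. *)
Record quasi_triangular (D : dend A) (D' : dend (dual A)) (r : tensor A A) :
    Prop := QuasiTriangular {
  qt_Dbialgebra : dendriform_Dbialgebra D D';
  qt_induced : D' = induced D r;
  qt_D_equation : D_equation D r;
  qt_invariant : LR_invariant D (skew r)
}.

Record factorizable (D : dend A) (D' : dend (dual A)) (r : tensor A A) :
    Prop := Factorizable {
  fact_quasi_triangular : quasi_triangular D D' r;
  fact_iso : bijective (rI r)
}.

End Bialgebra.

Fact scaler_add3 (K : fieldType) (A : vectType K) (c : K)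
    (x y z x' y' z' : A) :
  (c *: x + x') + (c *: y + y') + (c *: z + z') =
  c *: (x + y + z) + (x' + y' + z').
Proof. by rewrite !scalerDr (addrACA (c *: x)) [LHS]addrACA. Qed.

Section Double.
Variables (K : fieldType) (A : vectType K).

Definition dbl : vectType K := (A * dual A)%type.

Definition dend_double (D : dend A) (D' : dend (dual A)) : dend dbl := Dend
  (mkbil (fun u v : dbl => let: (x, xi) := u in let: (y, eta) := v in
     (dprec D x y + coadj (Lall D') eta x - coadj (Rsucc D') xi y,
      dprec D' xi eta - adj (Rsucc D) x eta + adj (Lall D) y xi) : dbl))
  (mkbil (fun u v : dbl => let: (x, xi) := u in let: (y, eta) := v in
     (dsucc D x y - coadj (Lprec D') eta x + coadj (Rall D') xi y,
      dsucc D' xi eta + adj (Rall D) x eta - adj (Lprec D) y xi) : dbl)).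

Lemma dend_double_precE D D' (x y : A) (xi eta : dual A) :
  dprec (dend_double D D') (x, xi) (y, eta) =
  (dprec D x y + coadj (Lall D') eta x - coadj (Rsucc D') xi y,
   dprec D' xi eta - adj (Rsucc D) x eta + adj (Lall D) y xi).
Proof.
rewrite /= mkbilE // => -[u u'] c [v v'] [w w'] /=; congr (_, _);
  rewrite !(linearP, add_lfunE, scale_lfunE);
  exact: scaler_add3.
Qed.

Lemma dend_double_succE D D' (x y : A) (xi eta : dual A) :
  dsucc (dend_double D D') (x, xi) (y, eta) =
  (dsucc D x y - coadj (Lprec D') eta x + coadj (Rall D') xi y,
   dsucc D' xi eta + adj (Rall D) x eta - adj (Lprec D) y xi).
Proof.
rewrite /= mkbilE // => -[u u'] c [v v'] [w w'] /=; congr (_, _);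
  rewrite !(linearP, add_lfunE, scale_lfunE);
  exact: scaler_add3.
Qed.

(** The canonical identification of [A^* (+) A] with the dual of
    [A (+) A^*]. *)
Definition dbl_pair : 'Hom((dual A * A)%type, dual dbl) :=
  mkbil (fun (p : (dual A * A)%type) (u : dbl) => p.1 u.1 + u.2 p.2 : K^o).

Lemma dbl_pairE (p : (dual A * A)%type) (u : dbl) :
  dbl_pair p u = p.1 u.1 + u.2 p.2.
Proof.
rewrite /dbl_pair mkbilE // => v c w z /=.
  by rewrite linearP add_lfunE scale_lfunE scalerDr addrACA.
by rewrite linearP add_lfunE scale_lfunE scalerDr addrACA.
Qed.

Definition dbl_unpair : 'Hom(dual dbl, (dual A * A)%type) := (dbl_pair^-1)%VF.

Lemma lker_dbl_pair : lker dbl_pair == 0%VS.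
Proof.
apply/lker0P=> p q epq; apply/eqP; rewrite -subr_eq0; apply/eqP.
have pq0 (u : dbl) : (p - q).1 u.1 + u.2 (p - q).2 = 0.
  by rewrite -dbl_pairE linearB /= epq subrr lfunE.
case: (p - q) pq0 => xi x pq0; congr (_, _).
  apply/lfunP=> y; rewrite lfunE /=.
  by have := pq0 (y, 0); rewrite /= lfunE /= addr0.
apply: dual_sep => eta.
by have := pq0 (0, eta); rewrite /= linear0 add0r.
Qed.

Lemma dbl_pairK : cancel dbl_pair dbl_unpair.
Proof. exact/lker0_lfunK/lker_dbl_pair. Qed.

Lemma dbl_unpairK : cancel dbl_unpair dbl_pair.
Proof.
move=> u; rewrite limg_lfunVK // (_ : limg _ = fullv) ?memvf //.
apply/eqP; rewrite eqEdim subvf limg_dim_eq /=; last first.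
  by rewrite (eqP lker_dbl_pair) capv0.
rewrite !dimvf dim_dual; apply/eq_leq.
by rewrite -[RHS]/(dim (dual A) + dim A)%N -[LHS]/(dim A + dim (dual A))%N
  addnC.
Qed.

Definition dstar (D : dend A) (D' : dend (dual A)) : dend (dual dbl) := Dend
  (mkbil (fun al be : dual dbl =>
     dbl_pair (dprec D' (dbl_unpair al).1 (dbl_unpair be).1,
               dprec D (dbl_unpair al).2 (dbl_unpair be).2)))
  (mkbil (fun al be : dual dbl =>
     dbl_pair (dsucc D' (dbl_unpair al).1 (dbl_unpair be).1,
               dsucc D (dbl_unpair al).2 (dbl_unpair be).2))).

Lemma dstar_precE D D' (xi eta : dual A) (x y : A) :
  dprec (dstar D D') (dbl_pair (xi, x)) (dbl_pair (eta, y)) =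
  dbl_pair (dprec D' xi eta, dprec D x y).
Proof.
rewrite /= mkbilE ?dbl_pairK // => u c v w;
  rewrite -linearP; congr (dbl_pair _); congr (_, _);
  by rewrite !(linearP, add_lfunE, scale_lfunE).
Qed.

Lemma dstar_succE D D' (xi eta : dual A) (x y : A) :
  dsucc (dstar D D') (dbl_pair (xi, x)) (dbl_pair (eta, y)) =
  dbl_pair (dsucc D' xi eta, dsucc D x y).
Proof.
rewrite /= mkbilE ?dbl_pairK // => u c v w;
  rewrite -linearP; congr (dbl_pair _); congr (_, _);
  by rewrite !(linearP, add_lfunE, scale_lfunE).
Qed.

End Double.

(* Main.v *)
(** On [d = A (+) A^*] the form [w((x, xi), (y, eta)) = <xi, y> - <eta, x>] is
    skew and nondegenerate, and
      [w(u > v, t) = w(v, t * u)],  [w(u < v, t) = w(u, v * t)],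
    so the dendriform axioms of [d] all follow from associativity of [*], which
    is the matched pair condition encoded by the D-bialgebra axioms on [A].  Let
    [q] be the projection of [d] onto [A^*].  Under the identification
    [phi : d -> d^*] given by [w], both products of [d_r^*] take the form
    [q u . v + u . q v - u . v]; moreover [r_+] becomes [q], [r_-] becomes
    [q - 1], [I] becomes the identity and [r - sigma(r)] becomes [-w].  Moving
    everything to one side of [w] reduces the bialgebra axioms to associativity
    and to the adjunction [w(q u, v) = w(u, v - q v)]; the D-equation says that
    [q] is a Rota-Baxter operator of weight [-1] for [*]. *)

Require Import Defs.
From mathcomp Require Import all_boot all_order all_algebra.
From mathcomp Require Import ring.

Import GRing.Theory.
Local Open Scope ring_scope.

(** * Linearity rules, separation by functionals, associativity of [dast] *)

Section LfunLinear.
Variables (K : fieldType) (U W : vectType K) (f : 'Hom(U, W)).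

Lemma lfunD x y : f (x + y) = f x + f y. Proof. exact: linearD. Qed.
Lemma lfunN x : f (- x) = - f x. Proof. exact: linearN. Qed.

End LfunLinear.

Definition lfunDNE := (lfunD, lfunN, add_lfunE, opp_lfunE).

Section TensorLinear.
Variables (K : fieldType) (A B : vectType K) (t s : tensor A B).

Lemma tensorD xi eta : (t + s) xi eta = t xi eta + s xi eta.
Proof. by rewrite !add_lfunE. Qed.

Lemma tensorN xi eta : (- t) xi eta = - t xi eta.
Proof. by rewrite !opp_lfunE. Qed.

End TensorLinear.

Lemma dual_ext (K : fieldType) (A : vectType K) (x y : A) :
  (forall xi : dual A, xi x = xi y) -> x = y.
Proof.
move=> xy; apply/eqP; rewrite -subr_eq0; apply/eqP/dual_sep => xi.
by rewrite linearB /= xy subrr.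
Qed.

Section DendriformOperators.
Variables (K : fieldType) (A : vectType K) (D : dend A).

Lemma LallE x y : Lall D x y = dast D x y.
Proof. by rewrite /Lall /dast !add_lfunE. Qed.

Lemma RallE x y : Rall D x y = dast D y x.
Proof. by rewrite /Rall /dast !add_lfunE !rmultE. Qed.

Lemma dastA : dendriform D ->
  forall x y z, dast D (dast D x y) z = dast D x (dast D y z).
Proof.
move=> hD x y z; rewrite [LHS]/dast -(dend_succ_succ hD) [dast D x y]/dast.
rewrite lfunD add_lfunE (dend_prec_prec hD) (dend_succ_prec hD).
by rewrite -addrA -lfunD.
Qed.

End DendriformOperators.

(** * The D-equation in terms of [r_+] and [r_-] *)

Section Contraction.
Variables (K : fieldType) (V : vectType K) (k : nat) (a b : 'I_k -> V).

Lemma rplus_sum xi :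
  rplus (\sum_i tens (a i) (b i)) xi = \sum_i xi (a i) *: b i.
Proof.
apply: dual_ext => eta; rewrite rplusE !sum_lfunE linear_sum.
by apply: eq_bigr => i _; rewrite tensE linearZ.
Qed.

Lemma rminus_sum eta :
  rminus (\sum_i tens (a i) (b i)) eta = \sum_i eta (b i) *: a i.
Proof.
apply: dual_ext => xi; rewrite rminusE !sum_lfunE linear_sum.
by apply: eq_bigr => i _; rewrite tensE linearZ /= [RHS]mulrC.
Qed.

End Contraction.

Lemma lfun_pair_sum (K : fieldType) (U V W : vectType K) (h : dual W)
    (f : 'Hom(U, 'Hom(V, W))) (k : nat) (c d : 'I_k -> K)
    (x : 'I_k -> U) (y : 'I_k -> V) :
  h (f (\sum_i c i *: x i) (\sum_j d j *: y j)) =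
  \sum_i \sum_j c i * d j * h (f (x i) (y j)).
Proof.
rewrite (linear_sum f) sum_lfunE linear_sum; apply: eq_bigr => i _.
rewrite !linear_sum; apply: eq_bigr => j _.
rewrite linearZ /= linearZ /= linearZ scale_lfunE linearZ.
by rewrite /= scalerA mulrC.
Qed.

Lemma tens_pair_sum (K : fieldType) (U V : vectType K) (k : nat)
    (c : 'I_k -> 'I_k -> K) (x : 'I_k -> 'I_k -> U) (y : 'I_k -> 'I_k -> V)
    (xi : dual U) (eta : dual V) :
  (\sum_i \sum_j c i j *: tens (x i j) (y i j)) xi eta =
  \sum_i \sum_j c i j * (xi (x i j) * eta (y i j)).
Proof.
rewrite !sum_lfunE; apply: eq_bigr => i _.
rewrite !sum_lfunE; apply: eq_bigr => j _.
by rewrite !scale_lfunE tensE.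
Qed.

(** Pairing the triple tensor with [xi], [eta], [zeta] pairs one leg of each copy of [r] with a
    functional: a paired first leg leaves a value of [r_+], a paired second leg a value of [r_-]. *)
Lemma D_equationP (K : fieldType) (V : vectType K) (D : dend V)
    (r : tensor V V) :
  (forall xi eta zeta : dual V,
     xi (dast D (rminus r eta) (rminus r zeta))
     - zeta (dprec D (rplus r xi) (rplus r eta))
     - eta (dsucc D (rminus r zeta) (rplus r xi)) = 0) ->
  D_equation D r.
Proof.
move=> rP k a b rE; apply/lfunP => xi.
(* Pairing only the first leg gives an element of the bidual of the remaining tensor product, so
   [ev] can be stripped before the other two legs are paired. *)
have contract (U : vectType K) (u : 'I_k -> 'I_k -> V)
    (s : 'I_k -> 'I_k -> U) :
    (\sum_i \sum_j tens (u i j) (s i j)) xi =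
    ev (\sum_i \sum_j xi (u i j) *: s i j).
  rewrite sum_lfunE linear_sum; apply: eq_bigr => i _.
  rewrite sum_lfunE linear_sum; apply: eq_bigr => j _.
  by apply/lfunP => T; rewrite tensE evE linearZ.
rewrite !(add_lfunE, opp_lfunE) zero_lfunE !contract -!lfunN -!lfunD.
rewrite -[RHS](linear0 ev); congr (ev _).
apply: tensor_ext => eta zeta; rewrite !(tensorD, tensorN).
rewrite !tens_pair_sum zero_lfunE zero_lfunE.
apply: etrans (rP xi eta zeta).
rewrite rE !rplus_sum !rminus_sum -LallE !lfun_pair_sum.
by congr (_ - _ - _); apply: eq_bigr => i _; apply: eq_bigr => j _;
  rewrite ?LallE; ring.
Qed.

(** * Bialgebras from a skew invariant form and a projection-like operator [q] *)

(* [m] stands for [dast D]: the latter is convertible to a sum, which rewriting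
   with additivity lemmas would expand. *)
Section Coboundary.
Variables (K : fieldType) (V : vectType K) (D : dend V) (D' : dend (dual V)).
Variables (m : 'Hom(V, 'End(V))) (phi : 'Hom(V, dual V)) (q : 'End(V)).
Hypothesis mE : forall x y, dast D x y = m x y.
Hypothesis mA : forall x y z, m (m x y) z = m x (m y z).
Hypothesis phi_bij : bijective phi.
Hypothesis phi_skew : forall u v, phi u v = - phi v u.
Hypothesis phi_succ : forall u v w, phi (dsucc D u v) w = phi v (m w u).
Hypothesis phi_prec : forall u v w, phi (dprec D u v) w = phi u (m v w).
Hypothesis phi_q : forall u v, phi (q u) v = phi u (v - q v).
Hypothesis dual_prec : forall u v, dprec D' (phi u) (phi v) =
  phi (dprec D (q u) v + dprec D u (q v) - dprec D u v).
Hypothesis dual_succ : forall u v, dsucc D' (phi u) (phi v) =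
  phi (dsucc D (q u) v + dsucc D u (q v) - dsucc D u v).

Let surj (P : dual V -> Prop) : (forall u, P (phi u)) -> forall xi, P xi.
Proof. by case: phi_bij => psi _ psiK Pphi xi; rewrite -(psiK xi). Qed.

Let surj_ev (P : dual (dual V) -> Prop) :
  (forall u, P (ev u)) -> forall X, P X.
Proof. by move=> Pev X; rewrite -(unevK X). Qed.

Lemma phi_ext u v : (forall w, phi u w = phi v w) -> u = v.
Proof. by move=> uv; apply: (bij_inj phi_bij); apply/lfunP. Qed.

(** Skewness extends the two adjunction hypotheses to every position of a product. The variants that
    follow differ in which factor is left alone inside the form. *)
Lemma phi_ml u v w : phi (m u v) w = phi u (dsucc D v w).
Proof. by rewrite phi_skew -phi_succ -phi_skew. Qed.

Lemma phi_mr u v w : phi (m u v) w = phi v (dprec D w u).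
Proof. by rewrite phi_skew -phi_prec -phi_skew. Qed.

Lemma phi_precr u v w : phi (dprec D u v) w = - phi v (dsucc D w u).
Proof. by rewrite phi_prec phi_skew phi_ml. Qed.

Lemma phi_succl u v w : phi (dsucc D u v) w = - phi u (dprec D v w).
Proof. by rewrite phi_succ phi_skew phi_mr. Qed.

Lemma phi_prec_rl b u v : phi b (dprec D u v) = - phi u (m v b).
Proof. by rewrite phi_skew phi_prec. Qed.

Lemma phi_prec_rr b u v : phi b (dprec D u v) = phi v (dsucc D b u).
Proof. by rewrite phi_skew phi_precr opprK. Qed.

Lemma phi_succ_rl b u v : phi b (dsucc D u v) = phi u (dprec D v b).
Proof. by rewrite phi_skew phi_succl opprK. Qed.

Lemma phi_succ_rr b u v : phi b (dsucc D u v) = - phi v (m b u).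
Proof. by rewrite phi_skew phi_succ. Qed.

(** Tested against [w], each axiom moves to an equality of two bracketings of a triple product under
    [m]. *)
Lemma dendriform_of_form : dendriform D.
Proof.
split=> x y z; rewrite ?mE; apply: phi_ext => w.
- by rewrite !phi_prec mA.
- by rewrite phi_prec !phi_succ phi_prec mA.
- by rewrite !phi_succ mA.
Qed.

Lemma phi_Lsucc b u : (phi b \o Lsucc D u)%VF = phi (m b u).
Proof. by apply/lfunP=> v; rewrite comp_lfunE /= phi_ml. Qed.

Lemma phi_Rprec b u : (phi b \o Rprec D u)%VF = phi (m u b).
Proof. by apply/lfunP=> v; rewrite comp_lfunE /= rmultE phi_mr. Qed.

Lemma phi_Lall b u : (phi b \o Lall D u)%VF = phi (dprec D b u).
Proof. by apply/lfunP=> v; rewrite comp_lfunE /= LallE mE phi_prec. Qed.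

Lemma phi_Rall b u : (phi b \o Rall D u)%VF = phi (dsucc D u b).
Proof. by apply/lfunP=> v; rewrite comp_lfunE /= RallE mE phi_succ. Qed.

Lemma dual_ast u v : dprec D' (phi u) (phi v) + dsucc D' (phi u) (phi v) =
  phi (m (q u) v + m u (q v) - m u v).
Proof.
apply/lfunP=> w; rewrite dual_prec dual_succ -!mE /dast !lfunDNE; ring.
Qed.

(** Transposes of the dual multiplications, read on [V]. Moving the product across the form turns
    [q c] into [c] paired with [1 - q]; the identity part cancels against the third term of the dual
    product. *)
Lemma ev_Lsucc a v : (ev v \o Lsucc D' (phi a))%VF =
  ev (m v (q a) - q (m v a)).
Proof.
apply/lfunP; apply: surj => c; rewrite comp_lfunE /= !evE dual_succ.
by rewrite !(lfunDNE, phi_succ, phi_q); ring.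
Qed.

Lemma ev_Rprec b u : (ev u \o Rprec D' (phi b))%VF =
  ev (m (q b) u - q (m b u)).
Proof.
apply/lfunP; apply: surj => c.
rewrite comp_lfunE /= !evE rmultE dual_prec.
by rewrite !(lfunDNE, phi_prec, phi_q); ring.
Qed.

Lemma ev_Lall a v : (ev v \o Lall D' (phi a))%VF =
  ev (dprec D v (q a) - q (dprec D v a)).
Proof.
apply/lfunP; apply: surj => c.
rewrite comp_lfunE /Lall !add_lfunE /= !evE !lfunDNE dual_succ dual_prec.
rewrite !(lfunDNE, phi_succ, phi_precr, phi_q) -!mE /dast.
by rewrite !lfunDNE; ring.
Qed.

Lemma ev_Rall b u : (ev u \o Rall D' (phi b))%VF =
  ev (dsucc D (q b) u - q (dsucc D b u)).
Proof.
apply/lfunP; apply: surj => c.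
rewrite comp_lfunE /Rall !add_lfunE /= !rmultE !evE !lfunDNE.
rewrite dual_succ dual_prec.
rewrite !(lfunDNE, phi_succl, phi_prec, phi_q) -!mE /dast.
by rewrite !lfunDNE; ring.
Qed.

(** As [phi] and [ev] are onto, each condition is tested on their values. Conditions (1), (2), (5)
    then follow from associativity of [m]; (3), (4), (6) use the transposes of the dual
    multiplications and one dendriform axiom each. *)
Lemma Dbialgebra_of_form : dendriform D' -> dendriform_Dbialgebra D D'.
Proof.
have hD := dendriform_of_form.
have evalE := (tensorD, tensorN, tmapE, flipE, copE, comp_lfun1r).
move=> hD'; split=> // [x y|x y|xi eta|xi eta|x y|xi eta].
- apply: tensor_ext; apply: surj => a; apply: surj => b.
  rewrite !evalE mE phi_Lsucc phi_Rall.
  rewrite !dual_prec !(lfunDNE, phi_prec, phi_succ, phi_q, mA).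
  ring.
- apply: tensor_ext; apply: surj => a; apply: surj => b.
  rewrite !evalE mE phi_Lall phi_Rprec.
  rewrite !dual_succ !(lfunDNE, phi_prec, phi_succ, phi_q, mA).
  ring.
- move: xi eta; apply: surj => a; apply: surj => b.
  apply: tensor_ext; apply: surj_ev => u; apply: surj_ev => v.
  (* Every term is brought to the form [phi a] of something, so that only the bracketing of [b],
     [u], [v] is left to compare. In condition (4) the terms are collected on [phi b] instead. *)
  rewrite !evalE ev_Lsucc ev_Rall !cocopE dual_ast [in RHS]phi_prec_rr.
  rewrite !(lfunDNE, phi_ml a, phi_ml (q a), phi_mr v, phi_q).
  rewrite -!(dend_succ_prec hD).
  ring.
- move: xi eta; apply: surj => a; apply: surj => b.
  apply: tensor_ext; apply: surj_ev => u; apply: surj_ev => v.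
  rewrite !evalE ev_Lall ev_Rprec !cocopE dual_ast (phi_succ_rl a).
  rewrite !(lfunDNE, phi_mr a, phi_mr (q a), phi_ml _ u, phi_q).
  rewrite !(dend_succ_prec hD).
  ring.
- apply: tensor_ext; apply: surj => a; apply: surj => b.
  rewrite !evalE zero_lfunE zero_lfunE.
  rewrite !(phi_Lall, phi_Rprec, phi_Lsucc, phi_Rall).
  rewrite !(dual_succ, dual_prec).
  rewrite !(lfunDNE, phi_prec, phi_succ, phi_q, mA).
  ring.
- move: xi eta; apply: surj => a; apply: surj => b.
  apply: tensor_ext; apply: surj_ev => u; apply: surj_ev => v.
  rewrite !evalE zero_lfunE zero_lfunE ev_Lall ev_Rprec ev_Lsucc ev_Rall.
  rewrite !cocopE (phi_prec_rl b (_ - _)) (phi_prec_rr b u).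
  rewrite !(lfunDNE, phi_q, phi_precr, phi_ml).
  rewrite !(dend_succ_succ hD) !mE.
  ring.
Qed.

Variable r : tensor V V.
Hypothesis rE : forall u v, r (phi u) (phi v) = phi v (q u).
Hypothesis q_RB : forall u v,
  q (m (q u) v + m u (q v) - m u v) = m (q u) (q v).

Lemma rplus_phi u : rplus r (phi u) = q u.
Proof. by apply: dual_ext; apply: surj => v; rewrite rplusE rE. Qed.

Lemma rminus_phi u : rminus r (phi u) = q u - u.
Proof.
apply: dual_ext; apply: surj => v; rewrite rminusE rE phi_skew phi_q !lfunDNE.
ring.
Qed.

Lemma rI_bij : bijective (rI r).
Proof.
have rK u : rI r (phi u) = u.
  by rewrite /rI !lfunDNE rplus_phi rminus_phi opprB addrC subrK.
by exists phi; [apply: surj => u; rewrite rK | exact: rK].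
Qed.

Lemma dual_induced : D' = induced D r.
Proof.
suff [preceq succeq] : dprec D' = dprec (induced D r) /\
    dsucc D' = dsucc (induced D r).
  by case: (D') (induced D r) preceq succeq => ? ? [? ?] /= -> ->.
split; apply/lfunP; apply: surj => a; apply/lfunP; apply: surj => b;
  apply/lfunP => w.
- rewrite induced_precE rplus_phi rminus_phi dual_prec.
  (* The induced product dictates the sides: terms with [q a] or with neither [q] are moved onto
     [phi b], the term with [q b] onto [phi a]. *)
  rewrite !(lfunDNE, adjE, LallE, mE, rmultE, phi_precr (q a)).
  rewrite (phi_precr a b) phi_prec.
  ring.
- rewrite induced_succE rplus_phi rminus_phi dual_succ.
  rewrite !(lfunDNE, adjE, RallE, mE, phi_succl a) phi_succ.
  ring.
Qed.

(* [skew] is also a notation of mathcomp's [sesquilinear], hence [Defs.skew]. *)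
Lemma skew_phi (u v : V) :
  Defs.skew r (phi u) (phi v) = (2%:R^-1 : K) * phi v u.
Proof.
rewrite /Defs.skew !scale_lfunE tensorD tensorN flipE !rE.
congr (_ * _); rewrite [phi u _]phi_skew phi_q !lfunDNE.
ring.
Qed.

(** The skew part is a multiple of the form, so its two invariance conditions are [phi_prec] and
    [phi_succ]. *)
Lemma skew_invariant : LR_invariant D (Defs.skew r).
Proof.
move=> x; split; apply: tensor_ext; apply: surj => a; apply: surj => b.
  rewrite tensorD tensorN !tmapE !comp_lfun1r phi_Lall phi_Rprec !skew_phi.
  by rewrite phi_prec zero_lfunE zero_lfunE subrr.
rewrite tensorD tensorN !tmapE !comp_lfun1r phi_Lsucc phi_Rall !flipE !skew_phi.
by rewrite phi_succ zero_lfunE zero_lfunE subrr.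
Qed.

(** Once everything is paired with [phi a], what remains is the Rota-Baxter identity for [b] and
    [c]. *)
Lemma D_equation_of_form : D_equation D r.
Proof.
apply: D_equationP; apply: surj => a; apply: surj => b; apply: surj => c.
rewrite mE !rplus_phi !rminus_phi.
have H := congr1 (phi a) (q_RB b c); rewrite !lfunDNE in H.
rewrite phi_prec_rl phi_succ_rr !(lfunDNE, phi_q) -H.
ring.
Qed.

End Coboundary.

(** * Associativity of the double as a matched pair *)

(* The [V]-component of associativity on [V (+) W]; the [W]-component is the
   same statement with [V, l, r] and [W, lam, rho] exchanged. *)
Lemma matched_pair_half (K : fieldType) (V W : vectType K)
  (mV : 'Hom(V, 'End(V))) (mW : 'Hom(W, 'End(W)))
  (l r : 'Hom(W, 'End(V))) (rho lam : 'Hom(V, 'End(W))) :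
  (forall x y z, mV (mV x y) z = mV x (mV y z)) ->
  (forall xi eta x, l xi (l eta x) = l (mW eta xi) x) ->
  (forall xi eta x, r xi (r eta x) = r (mW xi eta) x) ->
  (forall xi eta x, l xi (r eta x) = r eta (l xi x)) ->
  (forall xi x y, l xi (mV x y) = mV x (l xi y) + l (rho y xi) x) ->
  (forall xi x y, r xi (mV x y) = mV (r xi x) y + r (lam x xi) y) ->
  (forall xi x y, mV (l xi x) y + r (rho x xi) y =
                  mV x (r xi y) + l (lam y xi) x) ->
  forall x y z xi eta zeta,
  mV (mV x y + l eta x + r xi y) z + l zeta (mV x y + l eta x + r xi y)
    + r (mW xi eta + rho x eta + lam y xi) z =
  mV x (mV y z + l zeta y + r eta z)
    + l (mW eta zeta + rho y zeta + lam z eta) x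
    + r xi (mV y z + l zeta y + r eta z).
Proof.
move=> mA ll rr lr lm rm lrm x y z xi eta zeta.
rewrite !(lfunDNE, mA, ll, rr, lr, lm, rm).
(* The only terms left are those where [eta] stands between [x] and [z], which is this instance of
   the mixed condition. *)
have {}lrm := lrm eta x z.
apply: dual_ext => k; move/(congr1 k): lrm; rewrite !lfunDNE => lrm.
by rewrite (canRL (addrK _) lrm); ring.
Qed.

Section DoubleAssociative.
Variables (K : fieldType) (A : vectType K) (D : dend A) (D' : dend (dual A)).
Variables (m : 'Hom(A, 'End(A))) (m' : 'Hom(dual A, 'End(dual A))).
Hypothesis hD : dendriform_Dbialgebra D D'.
Hypothesis mE : forall x y, dast D x y = m x y.
Hypothesis m'E : forall xi eta, dast D' xi eta = m' xi eta.

(** Without signs, [l] and [rho] are right and left actions respectively: [x * eta] is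
    [(l eta x, rho x eta)] and [xi * y] is [(r xi y, lam y xi)]. *)
Let l := coadj (Lsucc D').
Let r := coadj (Rprec D').
Let rho := adj (Rprec D).
Let lam := adj (Lsucc D).

(** In the sum of the two products, subtracting the dual of [Lprec] from that of [Lall] leaves the
    dual of [Lsucc]; likewise [Rall] and [Rsucc] leave [Rprec]. *)
Lemma dast_double x y xi eta :
  dast (dend_double D D') (x, xi) (y, eta) =
  (m x y + l eta x + r xi y, m' xi eta + rho x eta + lam y xi).
Proof.
rewrite /dast dend_double_precE dend_double_succE -mE -m'E.
congr (_, _) => /=; [apply: dual_ext => k|apply/lfunP => k].
  rewrite !(lfunDNE, coadjE, adjE, LallE, RallE, rmultE) /dast ?lfunDNE.
  ring.
rewrite !(lfunDNE, coadjE, adjE, LallE, RallE, rmultE) /dast ?lfunDNE.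
ring.
Qed.

Let dA := Dbi_dendriform hD.
Let dA' := Dbi_dendriform_dual hD.

Let compE (F : 'Hom(A, 'End(A))) x (xi : dual A) : (xi \o F x)%VF = adj F x xi.
Proof. by apply/lfunP => y; rewrite adjE comp_lfunE. Qed.

Let evalE := (@tensorD, @tensorN, @tmapE, @flipE, @copE, @comp_lfun1r, compE).

Let Dbi1E x y xi eta : dprec D' xi eta (m x y) =
  dprec D' xi (adj (Lsucc D) x eta) y + dprec D' (adj (Rall D) y xi) eta x.
Proof.
move/lfunP: (Dbi1 hD x y) => /(_ xi) /lfunP /(_ eta).
by rewrite !evalE mE.
Qed.

Let Dbi2E x y xi eta : dsucc D' xi eta (m x y) =
  dsucc D' xi (adj (Lall D) x eta) y + dsucc D' (adj (Rprec D) y xi) eta x.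
Proof.
move/lfunP: (Dbi2 hD x y) => /(_ xi) /lfunP /(_ eta).
by rewrite !evalE mE.
Qed.

Let Dbi5E x y xi eta :
  dprec D' (adj (Lall D) x xi) eta y - dprec D' xi (adj (Rprec D) x eta) y
  + (dsucc D' (adj (Lsucc D) y eta) xi x - dsucc D' eta (adj (Rall D) y xi) x)
  = 0.
Proof.
move/lfunP: (Dbi5 hD x y) => /(_ xi) /lfunP /(_ eta).
by rewrite !evalE zero_lfunE zero_lfunE.
Qed.

Let evcompE (F : 'Hom(dual A, 'End(dual A))) xi (x : A) :
  (ev x \o F xi)%VF = ev (coadj F xi x).
Proof. by apply/lfunP => eta; rewrite evE coadjE comp_lfunE /= evE. Qed.

Let coevalE :=
  (@tensorD, @tensorN, @tmapE, @flipE, @cocopE, @comp_lfun1r, evcompE).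

Let Dbi3E xi eta x y : m' xi eta (dprec D x y) =
  eta (dprec D x (coadj (Lsucc D') xi y))
  + xi (dprec D (coadj (Rall D') eta x) y).
Proof.
move/lfunP: (Dbi3 hD xi eta) => /(_ (ev x)) /lfunP /(_ (ev y)).
by rewrite -m'E !coevalE.
Qed.

Let Dbi4E xi eta x y : m' xi eta (dsucc D x y) =
  eta (dsucc D x (coadj (Lall D') xi y))
  + xi (dsucc D (coadj (Rprec D') eta x) y).
Proof.
move/lfunP: (Dbi4 hD xi eta) => /(_ (ev x)) /lfunP /(_ (ev y)).
by rewrite -m'E !coevalE.
Qed.

Let Dbi6E (xi eta : dual A) (x y : A) :
  eta (dprec D (coadj (Lall D') xi x) y)
  - eta (dprec D x (coadj (Rprec D') xi y))
  + (xi (dsucc D (coadj (Lsucc D') eta y) x)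
     - xi (dsucc D y (coadj (Rall D') eta x))) = 0.
Proof.
move/lfunP: (Dbi6 hD xi eta) => /(_ (ev x)) /lfunP /(_ (ev y)).
by rewrite !coevalE zero_lfunE zero_lfunE.
Qed.

(** For the [A]-component, the two derivation rules of the matched pair come from (2) and (1), the
    mixed one from (5); for the dual component, from (4), (3) and (6). The pure action laws are the
    dendriform axioms. *)
Lemma dast_doubleA u v w :
  dast (dend_double D D') (dast (dend_double D D') u v) w =
  dast (dend_double D D') u (dast (dend_double D D') v w).
Proof.
case: u v w => [x xi] [y eta] [z zeta]; rewrite !dast_double; congr (_, _).
- apply: (@matched_pair_half _ _ _ m m' l r rho lam) => {x y z xi eta zeta}.
  + by move=> x y z; rewrite -!mE dastA.
  + move=> xi eta x; apply: dual_ext => k.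
    by rewrite !coadjE /= (dend_succ_succ dA') m'E.
  + move=> xi eta x; apply: dual_ext => k.
    by rewrite !coadjE !rmultE /= (dend_prec_prec dA') m'E.
  + move=> xi eta x; apply: dual_ext => k.
    by rewrite !coadjE !rmultE /= (dend_succ_prec dA').
  + move=> xi x y; apply: dual_ext => k.
    by rewrite lfunDNE !coadjE /= Dbi2E -mE -LallE -adjE coadjE.
  + move=> xi x y; apply: dual_ext => k.
    rewrite lfunDNE !coadjE !rmultE -!mE.
    (* Read as an operator, multiplication by the fixed factor can be transposed onto [k], as the
       evaluated condition (1) requires. *)
    rewrite -[dast D (r _ _) _]RallE -[k (Rall _ _ _)]adjE coadjE rmultE.
    by rewrite mE Dbi1E addrC.
  + move=> xi x y; apply: dual_ext => k.
    rewrite !lfunDNE !coadjE -!mE.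
    rewrite -[dast D (l _ _) _]RallE -[dast D _ (r _ _)]LallE.
    rewrite -[k (Rall _ _ _)]adjE -[k (Lall _ _ _)]adjE !coadjE !rmultE.
    have H := Dbi5E x y k xi.
    by apply/esym/eqP; rewrite -subr_eq0 -H; apply/eqP => /=; ring.
(* On the dual component [lam] plays the part of [l] and [rho] that of [r], so the mixed terms
   change order. *)
- rewrite ![_ + rho _ _ + lam _ _]addrAC ![_ + l _ _ + r _ _]addrAC.
  apply: (@matched_pair_half _ _ _ m' m lam rho r l) => {x y z xi eta zeta}.
  + by move=> x y z; rewrite -!m'E dastA.
  + move=> x y xi; apply/lfunP => k.
    by rewrite !adjE /= (dend_succ_succ dA) mE.
  + move=> x y xi; apply/lfunP => k.
    by rewrite !adjE !rmultE /= (dend_prec_prec dA) mE.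
  + move=> x y xi; apply/lfunP => k.
    by rewrite !adjE !rmultE /= (dend_succ_prec dA).
  + move=> x xi eta; apply/lfunP => k.
    rewrite lfunDNE !adjE Dbi4E -m'E -[dast D' _ _]LallE.
    by rewrite -(coadjE (Lall D')) adjE.
  + move=> x xi eta; apply/lfunP => k.
    rewrite lfunDNE !adjE !rmultE Dbi3E -m'E -[dast D' _ _]RallE.
    by rewrite -(coadjE (Rall D')) adjE rmultE addrC.
  + move=> x xi eta; apply/lfunP => k.
    rewrite !lfunDNE -!m'E -[dast D' (lam _ _) _]RallE.
    rewrite -[dast D' _ (rho _ _)]LallE !adjE !rmultE.
    rewrite -(coadjE (Rall D')) -(coadjE (Lall D')) !adjE !rmultE.
    have H := Dbi6E xi eta k x.
    by apply/esym/eqP; rewrite -subr_eq0 -H; apply/eqP => /=; ring.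
Qed.

End DoubleAssociative.

(** * The skew form and the projection on the double *)

Section DoubleForm.
Variables (K : fieldType) (A : vectType K) (D : dend A) (D' : dend (dual A)).

Definition dbl_form : 'Hom(dbl A, dual (dbl A)) :=
  linfun (fun u : dbl A => dbl_pair A (u.2, - u.1)).

Definition dbl_snd : 'End(dbl A) := linfun (fun u : dbl A => (0, u.2) : dbl A).

Lemma dbl_formE x xi : dbl_form (x, xi) = dbl_pair A (xi, - x).
Proof.
rewrite linfun_linE // => c u v; rewrite -linearP; congr (dbl_pair A _).
by congr (_, _); rewrite /= opprD scalerN.
Qed.

Lemma dbl_sndE x xi : dbl_snd (x, xi) = (0, xi).
Proof.
rewrite linfun_linE // => c u v; congr (_, _).
by rewrite /= scaler0 addr0.
Qed.

Lemma dbl_form_pair x y xi eta : dbl_form (x, xi) (y, eta) = xi y - eta x.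
Proof. by rewrite dbl_formE dbl_pairE /= linearN. Qed.

Lemma dbl_form_bij : bijective dbl_form.
Proof.
exists (fun al => (- (dbl_unpair A al).2, (dbl_unpair A al).1)) => [[x xi]|al].
  by rewrite dbl_formE dbl_pairK opprK.
by rewrite dbl_formE opprK -surjective_pairing dbl_unpairK.
Qed.

Lemma dbl_form_skew u v : dbl_form u v = - dbl_form v u.
Proof. by case: u v => [x xi] [y eta]; rewrite !dbl_form_pair opprB. Qed.

(** Both summands are isotropic, so each side is [xi y]. *)
Lemma dbl_form_snd u v : dbl_form (dbl_snd u) v = dbl_form u (v - dbl_snd v).
Proof.
case: u v => [x xi] [y eta].
rewrite !dbl_sndE -[(y, eta) - _]/(y - 0, eta - eta) !dbl_form_pair.
by rewrite subr0 subrr linear0 zero_lfunE.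
Qed.

Let dd := dend_double D D'.
Variables (m : 'Hom(A, 'End(A))) (m' : 'Hom(dual A, 'End(dual A))).
Hypothesis mE : forall x y, dast D x y = m x y.
Hypothesis m'E : forall xi eta, dast D' xi eta = m' xi eta.

Lemma dbl_form_succ u v w :
  dbl_form (dsucc (dend_double D D') u v) w =
  dbl_form v (dast (dend_double D D') w u).
Proof.
case: u v w => [x xi] [y eta] [z zeta].
rewrite (dast_double _ _ _ _ m m') // dend_double_succE !dbl_form_pair.
rewrite !(lfunDNE, coadjE, adjE, LallE, RallE, rmultE, mE, m'E) /=.
rewrite -!mE -!m'E /dast !lfunDNE.
ring.
Qed.

Lemma dbl_form_prec u v w :
  dbl_form (dprec (dend_double D D') u v) w =
  dbl_form u (dast (dend_double D D') v w).
Proof.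
case: u v w => [x xi] [y eta] [z zeta].
rewrite (dast_double _ _ _ _ m m') // dend_double_precE !dbl_form_pair.
rewrite !(lfunDNE, coadjE, adjE, LallE, RallE, rmultE, mE, m'E) /=.
rewrite -!mE -!m'E /dast !lfunDNE.
ring.
Qed.

(** The argument of the outer [q] equals [q u * q v - (u - q u) * (v - q v)]. Image and kernel of
    [q] are closed under [*], so [q] fixes the first product and kills the second. *)
Lemma dbl_snd_RB u v :
  dbl_snd (dast dd (dbl_snd u) v + dast dd u (dbl_snd v) - dast dd u v) =
  dast dd (dbl_snd u) (dbl_snd v).
Proof.
case: u v => [x xi] [y eta].
rewrite !dbl_sndE !(dast_double _ _ _ _ m m') //.
congr (_, _) => /=; rewrite !(linear0, zero_lfunE, addr0) //.
by apply/lfunP => z; rewrite !lfunDNE; ring.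
Qed.

(** The same decomposition shows that the bracket on the right is [(- (x . y), xi . eta)]; the sign
    in [dbl_form] restores [x . y]. *)
Lemma dstar_prec_form u v :
  dprec (dstar D D') (dbl_form u) (dbl_form v) =
  dbl_form (dprec dd (dbl_snd u) v + dprec dd u (dbl_snd v) - dprec dd u v).
Proof.
case: u v => [x xi] [y eta]; rewrite !dbl_sndE !dend_double_precE.
rewrite -[RHS]/(dbl_form (_, _)) !dbl_formE dstar_precE.
congr (dbl_pair A (_, _)) => /=.
  by apply/lfunP => z; rewrite !(linear0, zero_lfunE, lfunDNE); ring.
by apply: dual_ext => k; rewrite !(linear0, zero_lfunE, lfunDNE); ring.
Qed.

Lemma dstar_succ_form u v :
  dsucc (dstar D D') (dbl_form u) (dbl_form v) =
  dbl_form (dsucc dd (dbl_snd u) v + dsucc dd u (dbl_snd v) - dsucc dd u v).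
Proof.
case: u v => [x xi] [y eta]; rewrite !dbl_sndE !dend_double_succE.
rewrite -[RHS]/(dbl_form (_, _)) !dbl_formE dstar_succE.
congr (dbl_pair A (_, _)) => /=.
  by apply/lfunP => z; rewrite !(linear0, zero_lfunE, lfunDNE); ring.
by apply: dual_ext => k; rewrite !(linear0, zero_lfunE, lfunDNE); ring.
Qed.

Lemma dendriform_dstar : dendriform D -> dendriform D' ->
  dendriform (dstar D D').
Proof.
move=> dA dA'.
have surj (P : dual (dbl A) -> Prop) :
    (forall xi x, P (dbl_pair A (xi, x))) -> forall al, P al.
  by move=> Pp al; rewrite -(dbl_unpairK al); case: (dbl_unpair _ _).
have astE xi eta x y : dast (dstar D D') (dbl_pair A (xi, x))
    (dbl_pair A (eta, y)) = dbl_pair A (dast D' xi eta, dast D x y).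
  by rewrite /dast dstar_precE dstar_succE -lfunD.
split; apply: (surj) => xi x; apply: (surj) => eta y; apply: (surj) => zeta z;
  rewrite ?astE !(dstar_precE, dstar_succE).
- by rewrite (dend_prec_prec dA) (dend_prec_prec dA').
- by rewrite (dend_succ_prec dA) (dend_succ_prec dA').
- by rewrite (dend_succ_succ dA) (dend_succ_succ dA').
Qed.

End DoubleForm.

(** * The canonical element and the conclusion for the double *)

Lemma dual_basis_sum (K : fieldType) (A : vectType K) (n : nat)
    (e : n.-tuple A) (es : n.-tuple (dual A)) (x : A) :
  basis_of {:A} e ->
  (forall i j : 'I_n, tnth es i (tnth e j) = (i == j)%:R) ->
  \sum_i tnth es i x *: tnth e i = x.
Proof.
move=> he hes; rewrite [in RHS](coord_basis he (memvf x)).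
apply: eq_bigr => i _; rewrite -tnth_nth; congr (_ *: _).
rewrite {1}(coord_basis he (memvf x)) linear_sum (bigD1 i) //= big1 => [|j ji].
  by rewrite -tnth_nth linearZ /= hes eqxx addr0 [LHS]mulr1.
by rewrite -tnth_nth linearZ /= hes eq_sym (negPf ji) [LHS]mulr0.
Qed.

Theorem theorem2p21 (K : fieldType) (hK : 2%N \notin [pchar K])
  (A : vectType K) (D : dend A) (D' : dend (dual A))
  (hD : dendriform_Dbialgebra D D')
  (n : nat) (e : n.-tuple A) (es : n.-tuple (dual A))
  (he : basis_of {:A} e)
  (hes : forall i j : 'I_n, tnth es i (tnth e j) = (i == j)%:R) :
  let r : tensor (dbl A) (dbl A) :=
    \sum_(i < n) tens ((tnth e i, 0) : dbl A) ((0, tnth es i) : dbl A) in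
  quasi_triangular (dend_double D D') (dstar D D') r
  /\ factorizable (dend_double D D') (dstar D D') r.
Proof.
move=> r; set dd := dend_double D D'.
set phi := dbl_form K A; set q := dbl_snd K A.
(* [Lall] packages [dast] as a bilinear map, as needed to instantiate [m]. *)
have LE (B : vectType K) (E : dend B) x y : dast E x y = Lall E x y.
  by rewrite LallE.
(* Both sides are [- xi y]: the dual bases reassemble [y] from the terms [- xi(e_i) e_i^*(y)]. *)
have r_form u v : r (phi u) (phi v) = phi v (q u).
  case: u v => [x xi] [y eta]; rewrite dbl_sndE dbl_form_pair linear0 sub0r.
  rewrite !sum_lfunE -[in RHS](dual_basis_sum _ _ _ _ _ y he hes) linear_sum.
  rewrite -sumrN; apply: eq_bigr => i _; rewrite tensE !dbl_form_pair.
  by rewrite linear0 zero_lfunE linearZ /= subr0 sub0r mulrN mulrC.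
have RB u v : q (Lall dd (q u) v + Lall dd u (q v) - Lall dd u v) =
    Lall dd (q u) (q v).
  by rewrite -!LE; apply: dbl_snd_RB; exact: LE.
have mA u v w : Lall dd (Lall dd u v) w = Lall dd u (Lall dd v w).
  by rewrite -!LE; apply: dast_doubleA hD _ _ _ _ _; exact: LE.
have bij : bijective phi := dbl_form_bij K A.
have skewW := dbl_form_skew K A.
have snd := dbl_form_snd K A.
have succW u v w : phi (dsucc dd u v) w = phi v (Lall dd w u).
  by rewrite -LE; apply: dbl_form_succ; exact: LE.
have precW u v w : phi (dprec dd u v) w = phi u (Lall dd v w).
  by rewrite -LE; apply: dbl_form_prec; exact: LE.
have dprecE := dstar_prec_form K A D D'.
have dsuccE := dstar_succ_form K A D D'.
have dA : dendriform (dstar D D').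
  exact: dendriform_dstar (Dbi_dendriform hD) (Dbi_dendriform_dual hD).
have qt : quasi_triangular dd (dstar D D') r.
  split.
  - apply: (@Dbialgebra_of_form _ _ _ _ (Lall dd) phi q);
      solve [assumption | exact: LE].
  - apply: (@dual_induced _ _ _ _ (Lall dd) phi q);
      solve [assumption | exact: LE].
  - apply: (@D_equation_of_form _ _ _ (Lall dd) phi q);
      solve [assumption | exact: LE].
  - apply: (@skew_invariant _ _ _ (Lall dd) phi q);
      solve [assumption | exact: LE].
split=> //; split=> //.
exact: (rI_bij _ _ _ _ bij skewW snd r r_form).
Qed.
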